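(* Let $m\in\{1,2\}$, let $\lambda,\mu>0$, and let $(U,V,G,P)(t,x,\theta)$, $t\in[0,T)$, $x\ge 0$, be a smooth solution of the polar background system (BS) stated in the context that satisfies the ridge-flat ansatz $$(P_\theta,V_\theta,U_\theta,G_\theta)\big|_{\theta=\theta_0}=0\ \ (\theta_0=0,\pi),\qquad (P_\theta,V_\theta,U_\theta,G_\theta)\big|_{\theta=\theta_1}=0\ \ (\theta_1=\pm\tfrac{\pi}{2}),$$ for all $x\ge0$, $t\in[0,T)$ (equivalently, $U,V,G,P$ are even functions of $(r,z)=(x\cos\theta,x\sin\theta)$). (A) For $\theta_0\in\{0,\pi\}$ put $u(t,x)=U(t,x,\theta_0)$, $v(t,x)=V(t,x,\theta_0)$, $g(t,x)=G(t,x,\theta_0)$, $p(t,x)=P(t,x,\theta_0)$. Then $(u,v)$ satisfies the $(1+1)$-dimensional system (R0) $$\lambda u_t=xvu_x+\tfrac{m^2}{2}vu,$$ $$\lambda\Bigl(v+\tfrac{1}{\mu+m}xv_x\Bigr)_t=\tfrac{\mu-m^2}{\mu+m}v^2-\tfrac{\mu}{\mu+m}u^2+\tfrac{\mu+1-m}{\mu+m}xvv_x-\tfrac{1}{\mu+m}x^2\bigl(v_x^2-vv_{xx}\bigr),$$ and $g,p$ are determined by $$g=mv+xv_x,\qquad p_x=x\bigl(\lambda v_t+u^2-v^2-xvv_x\bigr).$$ (B) At the apex $x=0$ the system (R0) reduces to the closed pointwise ODE $$\lambda u_t=\tfrac{m^2}{2}vu,\qquad \lambda v_t=\tfrac{\mu-m^2}{\mu+m}v^2-\tfrac{\mu}{\mu+m}u^2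 .$$ If moreover $\lambda=\frac{q+1}{q}m^2$ and $\mu=\frac{2q+m}{2q-m^2}m^2$ with $q>\frac{m^2}{2}$, this ODE becomes $$u_t=\tfrac{q}{2(q+1)}uv,\qquad v_t=\tfrac{1}{2(q+1)}\Bigl(v^2-\tfrac{2q+m}{m(m+1)}u^2\Bigr),$$ and eliminating $u^2$ yields, with $u_0,v_0$ the values of $u,v$ at $t=0$, $x=0$, $$v_{tt}=vv_t-\tfrac{q}{2(q+1)^2}v^3,\qquad v(0)=v_0,\qquad v_t(0)=\tfrac{1}{2(q+1)}\Bigl(v_0^2-\tfrac{2q+m}{m(m+1)}u_0^2\Bigr).$$ (C) For $\theta_1\in\{\pm\frac{\pi}{2}\}$ put $\bar u(t,x)=U(t,x,\theta_1)$, $\bar v(t,x)=V(t,x,\theta_1)$, $\bar g(t,x)=G(t,x,\theta_1)$, $\bar p(t,x)=P(t,x,\theta_1)$. Then $(\bar u,\bar g)$ satisfies the $(1+1)$-dimensional system (Z0) $$\lambda\bar u_t=\tfrac m2\bar g\bar u+\tfrac m2x\bar u\bar g_x-x\bar g\bar u_x,$$ $$\lambda\Bigl(\bar g+\tfrac{\mu}{\mu+m}x\bar g_x\Bigr)_t=\tfrac{\mu-m^2}{m(\mu+m)}\bar g^2-\tfrac{\mu m}{\mu+m}\bar u^2-\tfrac{2\mu(m-1)+m^2}{m(\mu+m)}x\bar g\bar g_x+\tfrac{\mu}{m(\mu+m)}x^2\bigl(\bar g_x^2-m\bar g\bar g_{xx}\bigr),$$ and $\bar v,\bar p$ are determined by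 $$\bar v=\tfrac1m(\bar g+x\bar g_x),\qquad \bar p_x=-\tfrac1\mu x\bigl(\lambda\bar g_t+\bar g^2+x\bar g\bar g_x\bigr).$$ (D) At the apex $x=0$ the system (Z0) reduces to the closed pointwise ODE $$\lambda\bar u_t=\tfrac m2\bar g\bar u,\qquad \lambda\bar g_t=\tfrac{\mu-m^2}{m(\mu+m)}\bar g^2-\tfrac{\mu m}{\mu+m}\bar u^2,$$ which is identical to the first ODE in (B) if $\bar g$ is replaced by $mv$ (and $\bar u$ by $u$).
   Context: The unified system (E$m$) ($m=1$: 2D inviscid Boussinesq; $m=2$: 3D axisymmetric Euler), with time-scaling parameter $\lambda$ and $z^2$-scaling parameter $\mu$, for functions $\tilde u,\tilde v,\tilde g,\tilde p$ of $(t,r,z)\in[0,T)\times\mathbb R^2$, is $$\tfrac{D}{Dt}\tilde u=\tfrac12m^2\tilde u\tilde v,\quad \tfrac{D}{Dt}\tilde v=\tilde v^2-\tilde u^2+\tfrac1r\tilde p_r,\quad \tfrac{D}{Dt}\tilde g=-\tilde g^2-\tfrac{\mu}{z}\tilde p_z,\quad z\partial_z\tilde g-r\partial_r\tilde v+\tilde g-m\tilde v=0,$$ with $\frac{D}{Dt}=\lambda\partial_t-\tilde v\,r\partial_r+\tilde g\,z\partial_z$. All unknowns are even in $r$ and in $z$. In polar coordinates $r=x\cos\theta$, $z=x\sin\theta$, with $\tilde u=U(t,x,\theta)$, $\tilde v=V(t,x,\theta)$, $\tilde g=G(t,x,\theta)$, $\tilde p=P(t,x,\theta)$ and $W:=G\sin^2\theta-V\cos^2\theta$,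 the system takes the form (BS): $$\lambda U_t-\tfrac12m^2VU=-xU_xW-\tfrac12\sin(2\theta)(G+V)U_\theta,$$ $$\lambda V_t-V^2+U^2=-xV_xW+\tfrac1xP_x-\tfrac12\sin(2\theta)(G+V)V_\theta-\tfrac{\tan\theta}{x^2}P_\theta,$$ $$\lambda G_t+G^2=-xG_xW-\tfrac{\mu}{x}P_x-\tfrac12\sin(2\theta)(G+V)G_\theta-\tfrac{\mu\cot\theta}{x^2}P_\theta,$$ $$G-mV=-x\partial_xW-\tfrac12\sin(2\theta)(V_\theta+G_\theta).$$ Subscripts denote partial derivatives.
   Formalization: (BS) is required also at the ridges with the singular tan/cot multiple of P_θ taken as 0, which forces P_θθ=0 there for x>0; without this U=0, V=1, G=m, P=-r²/2-(m²/μ)z²/2 violates (R0) when μ≠m². *)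

(* Defs.v *)
From Stdlib Require Export Reals.
From Coquelicot Require Export Coquelicot.
Open Scope R_scope.

Definition d1 (f : R -> R -> R -> R) (t x th : R) : R := Derive (fun s => f s x th) t.
Definition d2 (f : R -> R -> R -> R) (t x th : R) : R := Derive (fun y => f t y th) x.
Definition d3 (f : R -> R -> R -> R) (t x th : R) : R := Derive (fun a => f t x a) th.

Definition dt (f : R -> R -> R) (t x : R) : R := Derive (fun s => f s x) t.
Definition dx (f : R -> R -> R) (t x : R) : R := Derive (fun y => f t y) x.

Fixpoint Cn_on (n : nat) (O : R * R * R -> Prop) (f : R -> R -> R -> R) : Prop :=
  match n with
  | 0%nat => forall t x th, O (t, x, th) ->
      continuous (fun p : R * R * R => f (fst (fst p)) (snd (fst p)) (snd p)) (t, x, th)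
  | S k =>
      (forall t x th, O (t, x, th) ->
         ex_derive (fun s => f s x th) t /\
         ex_derive (fun y => f t y th) x /\
         ex_derive (fun a => f t x a) th) /\
      Cn_on k O (d1 f) /\ Cn_on k O (d2 f) /\ Cn_on k O (d3 f)
  end.

Definition dom (T : R) (p : R * R * R) : Prop :=
  0 <= fst (fst p) < T /\ 0 <= snd (fst p).

(* Smoothness on a set that is not open, in the usual sense: the function is
   smooth on an open neighbourhood of the set.  At the boundary points t = 0
   and x = 0 the two-sided derivatives are then the one-sided ones, so they do
   not depend on the values outside the set. *)
Definition smooth_on (D : R * R * R -> Prop) (f : R -> R -> R -> R) : Prop :=
  exists O : R * R * R -> Prop,
    open O /\ (forall p, D p -> O p) /\ (forall n, Cn_on n O f).

Definition angular (T : R) (f : R -> R -> R -> R) : Prop :=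
  forall t x th, dom T (t, x, th) -> f t x (th + 2 * PI) = f t x th.

Definition Wfun (V G : R -> R -> R -> R) (t x th : R) : R :=
  G t x th * (sin th) ^ 2 - V t x th * (cos th) ^ 2.

Definition BS_at (m lambda mu : R) (U V G P : R -> R -> R -> R) (t x th : R) : Prop :=
  let W := Wfun V G in
  (lambda * d1 U t x th - 1 / 2 * m ^ 2 * V t x th * U t x th
   = - x * d2 U t x th * W t x th
     - 1 / 2 * sin (2 * th) * (G t x th + V t x th) * d3 U t x th) /\
  (lambda * d1 V t x th - V t x th ^ 2 + U t x th ^ 2
   = - x * d2 V t x th * W t x th + 1 / x * d2 P t x th
     - 1 / 2 * sin (2 * th) * (G t x th + V t x th) * d3 V t x th
     - (sin th / cos th) / x ^ 2 * d3 P t x th) /\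
  (lambda * d1 G t x th + G t x th ^ 2
   = - x * d2 G t x th * W t x th - mu / x * d2 P t x th
     - 1 / 2 * sin (2 * th) * (G t x th + V t x th) * d3 G t x th
     - mu * (cos th / sin th) / x ^ 2 * d3 P t x th) /\
  (G t x th - m * V t x th
   = - x * d2 W t x th
     - 1 / 2 * sin (2 * th) * (d3 V t x th + d3 G t x th)).

(* The equations hold for every angle, the ridges included.  There tan or cot
   is singular, and the singular term is a multiple of P_theta, which the
   ridge-flat ansatz makes 0: the term is 0 whatever value x / 0 has.  Since the
   remaining terms are continuous in theta, the products P_theta tan and
   P_theta cot then also tend to 0 at the ridges where they are singular. *)
Record BS_solution (m lambda mu T : R) (U V G P : R -> R -> R -> R) : Prop := {
  BS_smooth : smooth_on (dom T) U /\ smooth_on (dom T) V /\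
              smooth_on (dom T) G /\ smooth_on (dom T) P;
  BS_angular : angular T U /\ angular T V /\ angular T G /\ angular T P;
  BS_eqs : forall t x th, 0 <= t < T -> 0 < x -> BS_at m lambda mu U V G P t x th
}.

Definition flat_at (T th0 : R) (U V G P : R -> R -> R -> R) : Prop :=
  forall t x, 0 <= t < T -> 0 <= x ->
    d3 P t x th0 = 0 /\ d3 V t x th0 = 0 /\ d3 U t x th0 = 0 /\ d3 G t x th0 = 0.

Definition ridge_flat (T : R) (U V G P : R -> R -> R -> R) : Prop :=
  flat_at T 0 U V G P /\ flat_at T PI U V G P /\
  flat_at T (PI / 2) U V G P /\ flat_at T (- (PI / 2)) U V G P.

Definition R0_at (m lambda mu : R) (u v : R -> R -> R) (t x : R) : Prop :=
  (lambda * dt u t x = x * v t x * dx u t x + m ^ 2 / 2 * v t x * u t x) /\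
  (lambda * dt (fun s y => v s y + 1 / (mu + m) * y * dx v s y) t x
   = (mu - m ^ 2) / (mu + m) * v t x ^ 2
     - mu / (mu + m) * u t x ^ 2
     + (mu + 1 - m) / (mu + m) * x * v t x * dx v t x
     - 1 / (mu + m) * x ^ 2 * (dx v t x ^ 2 - v t x * dx (dx v) t x)).

Definition Z0_at (m lambda mu : R) (u g : R -> R -> R) (t x : R) : Prop :=
  (lambda * dt u t x
   = m / 2 * g t x * u t x + m / 2 * x * u t x * dx g t x - x * g t x * dx u t x) /\
  (lambda * dt (fun s y => g s y + mu / (mu + m) * y * dx g s y) t x
   = (mu - m ^ 2) / (m * (mu + m)) * g t x ^ 2
     - mu * m / (mu + m) * u t x ^ 2
     - (2 * mu * (m - 1) + m ^ 2) / (m * (mu + m)) * x * g t x * dx g t x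
     + mu / (m * (mu + m)) * x ^ 2 * (dx g t x ^ 2 - m * g t x * dx (dx g) t x)).

Definition R_apex_at (m lambda mu : R) (u v : R -> R) (t : R) : Prop :=
  (lambda * Derive u t = m ^ 2 / 2 * v t * u t) /\
  (lambda * Derive v t
   = (mu - m ^ 2) / (mu + m) * v t ^ 2 - mu / (mu + m) * u t ^ 2).

Definition Z_apex_at (m lambda mu : R) (u g : R -> R) (t : R) : Prop :=
  (lambda * Derive u t = m / 2 * g t * u t) /\
  (lambda * Derive g t
   = (mu - m ^ 2) / (m * (mu + m)) * g t ^ 2 - mu * m / (mu + m) * u t ^ 2).

Definition q_apex_at (m q : R) (u v : R -> R) (t : R) : Prop :=
  (Derive u t = q / (2 * (q + 1)) * u t * v t) /\
  (Derive v t
   = 1 / (2 * (q + 1)) * (v t ^ 2 - (2 * q + m) / (m * (m + 1)) * u t ^ 2)).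

Definition q_second_order_ivp (m q T u0 v0 : R) (v : R -> R) : Prop :=
  (forall t, 0 <= t < T ->
     Derive_n v 2 t = v t * Derive v t - q / (2 * (q + 1) ^ 2) * v t ^ 3) /\
  v 0 = v0 /\
  Derive v 0 = 1 / (2 * (q + 1)) * (v0 ^ 2 - (2 * q + m) / (m * (m + 1)) * u0 ^ 2).

(* Main.v *)
From Stdlib Require Import Lra.
Require Import Defs.

(** On a ridge sin(2 theta) = 0 and all theta-derivatives vanish, so (BS)
    restricts to equations in (t, x) alone, in which W is -v (theta = 0, pi) or
    g (theta = pi/2, -pi/2).  The fourth equation expresses g through v (resp. v
    through g); inserting this, and the p_x given by one of the two momentum
    equations, into the other one gives (R0) (resp. (Z0)).  Everything holds for
    x > 0 and passes to x = 0 by continuity.  The second-order equation for v is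
    the time derivative of the apex ODE, from which u is eliminated. *)

(** * Values and derivatives determined from the right *)

(** One-sided vanishing is what is needed at t = 0 and x = 0, where the
    equations are available only to the right. *)
Lemma vanish_right (F : R -> R) (x d : R) :
  0 < d -> ex_derive F x -> (forall y, x < y < x + d -> F y = 0) ->
  F x = 0 /\ Derive F x = 0.
Proof.
intros Hd HF H0.
assert (E : F x = 0).
{ destruct (Req_dec (F x) 0) as [E|E]; trivial; exfalso.
  (* With tolerance |F x|, continuity would give |0 - F x| < |F x| at a point slightly to the
     right. *)
  destruct (proj2 (continuity_pt_filterlim F x)
              (ex_derive_continuous F x HF) _ (Rabs_pos_lt _ E)) as [a [Ha H]].
  set (h := Rmin a d / 2).
  assert (Hm := Rmin_l a d). assert (Hm' := Rmin_r a d).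
  assert (Hp := Rmin_pos a d Ha Hd).
  specialize (H (x + h)); simpl in H; unfold Rdist in H.
  rewrite (H0 (x + h)) in H by (unfold h; lra).
  replace (0 - F x) with (- F x) in H by ring.
  rewrite Rabs_Ropp in H.
  apply (Rlt_irrefl (Rabs (F x))), H; repeat split.
  - unfold h; lra.
  - replace (x + h - x) with h by ring; rewrite Rabs_right; unfold h; lra. }
split; trivial.
destruct (Req_dec (Derive F x) 0) as [E'|E']; trivial; exfalso.
(* The same contradiction with tolerance |F'(x)|: the difference quotients from the right are all
   0. *)
destruct (proj1 (is_derive_Reals F x _) (Derive_correct F x HF) _
            (Rabs_pos_lt _ E')) as [[a Ha] H]; simpl in H.
set (h := Rmin a d / 2).
assert (Hm := Rmin_l a d). assert (Hm' := Rmin_r a d).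
assert (Hp := Rmin_pos a d Ha Hd).
specialize (H h); rewrite (H0 (x + h)), E in H by (unfold h; lra).
replace ((0 - 0) / h - Derive F x) with (- Derive F x) in H
  by (field; unfold h; lra).
rewrite Rabs_Ropp in H.
apply (Rlt_irrefl (Rabs (Derive F x))), H; [|rewrite Rabs_right]; unfold h; lra.
Qed.

Lemma eq_right (f h : R -> R) (x d : R) :
  0 < d -> ex_derive f x -> ex_derive h x ->
  (forall y, x < y < x + d -> f y = h y) ->
  f x = h x /\ Derive f x = Derive h x.
Proof.
intros Hd Hf Hh E.
destruct (vanish_right (fun y => f y - h y) x d Hd) as [H1 H2].
- auto_derive; repeat split; assumption.
- intros y Hy; rewrite (E y Hy); ring.
- rewrite Derive_minus in H2 by assumption; lra.
Qed.

Lemma eq_at_apex (f h : R -> R) :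
  ex_derive f 0 -> ex_derive h 0 -> (forall y, 0 < y -> f y = h y) ->
  forall y, 0 <= y -> f y = h y.
Proof.
intros Hf Hh E y [Hy|<-]; [exact (E y Hy)|].
apply (eq_right f h 0 1); trivial; [lra|]; intros z Hz; apply E; lra.
Qed.

(** * Smooth functions of t and x *)

(** Existence of iterated partial derivatives is all that is recorded: each step below
    differentiates in one variable at a time, and mixed derivatives keep their order. *)
Fixpoint deriv_upto (n : nat) (T : R) (f : R -> R -> R) : Prop :=
  match n with
  | O => True
  | S k =>
      (forall t x, 0 <= t < T -> 0 <= x ->
         ex_derive (fun s => f s x) t /\ ex_derive (fun y => f t y) x) /\
      deriv_upto k T (dt f) /\ deriv_upto k T (dx f)
  end.

Definition smooth2 (T : R) (f : R -> R -> R) : Prop := forall n, deriv_upto n T f.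

Lemma smooth2_dt T f : smooth2 T f -> smooth2 T (dt f).
Proof. intros H n; exact (proj1 (proj2 (H (S n)))). Qed.

Lemma smooth2_dx T f : smooth2 T f -> smooth2 T (dx f).
Proof. intros H n; exact (proj2 (proj2 (H (S n)))). Qed.

Lemma smooth2_ex_dt T f t x :
  smooth2 T f -> 0 <= t < T -> 0 <= x -> ex_derive (fun s => f s x) t.
Proof. intros H Ht Hx; exact (proj1 (proj1 (H 1%nat) t x Ht Hx)). Qed.

Lemma smooth2_ex_dx T f t x :
  smooth2 T f -> 0 <= t < T -> 0 <= x -> ex_derive (fun y => f t y) x.
Proof. intros H Ht Hx; exact (proj2 (proj1 (H 1%nat) t x Ht Hx)). Qed.

(** The t- and x-derivatives of a slice are, by conversion, slices of [d1 f] and [d2 f], so the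
    induction runs over [f]. *)
Lemma smooth2_slice T f th :
  smooth_on (dom T) f -> smooth2 T (fun t x => f t x th).
Proof.
intros [O [_ [HO Hf]]] n; specialize (Hf n); revert f Hf.
induction n as [|n IH]; intros f Hf; [exact I|].
destruct Hf as [H [H1 [H2 _]]]; repeat split.
- apply (H t x th), HO; split; assumption.
- apply (H t x th), HO; split; assumption.
- exact (IH _ H1).
- exact (IH _ H2).
Qed.

#[local] Hint Resolve smooth2_dt smooth2_dx smooth2_ex_dt smooth2_ex_dx : smooth.


Ltac ex_derive_smooth :=
  auto_derive; repeat split; eauto 12 with smooth real.

(** Expands the left side of (R0), with [c] equal to 1 / (mu + m), and of (Z0), with [c] equal to mu
    / (mu + m). *)
Lemma dt_add_xdx T f c t x :
  smooth2 T f -> 0 <= t < T -> 0 <= x ->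
  dt (fun s y => f s y + c * y * dx f s y) t x = dt f t x + c * x * dt (dx f) t x.
Proof.
intros Hf Ht Hx; apply is_derive_unique.
auto_derive; [repeat split; eauto with smooth|unfold dt; ring].
Qed.

(** * From the restricted equations to (R0) and (Z0) *)

(** Adding mu times the v-equation to the g-equation cancels the pressure; after g = m v + x v_x is
    inserted, the sum is mu + m times the second equation of (R0). *)
Lemma radial_ridge (m lambda mu T : R) (u v g p : R -> R -> R) :
  mu + m <> 0 ->
  smooth2 T u -> smooth2 T v -> smooth2 T g -> smooth2 T p ->
  (forall t x, 0 <= t < T -> 0 < x ->
     lambda * dt u t x = x * v t x * dx u t x + m ^ 2 / 2 * v t x * u t x /\
     lambda * dt v t x - v t x ^ 2 + u t x ^ 2
     = x * v t x * dx v t x + dx p t x / x /\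
     lambda * dt g t x + g t x ^ 2 = x * v t x * dx g t x - mu * (dx p t x / x) /\
     g t x = m * v t x + x * dx v t x) ->
  forall t x, 0 <= t < T -> 0 <= x ->
    R0_at m lambda mu u v t x /\
    g t x = m * v t x + x * dx v t x /\
    dx p t x = x * (lambda * dt v t x + u t x ^ 2 - v t x ^ 2
                    - x * v t x * dx v t x).
Proof.
intros Hm Hu Hv Hg Hp Heq t x Ht Hx; unfold R0_at.
rewrite (dt_add_xdx T) by assumption.
(* Both sides of each claim are differentiable in x, so x > 0 may be assumed, where p_x / x makes
   sense. *)
repeat split; revert x Hx; (apply eq_at_apex; [ex_derive_smooth|ex_derive_smooth|]);
  intros x Hx; pose proof (Heq t x Ht Hx) as [E1 [E2 [E3 E4]]].
- lra.
- assert (Et : dt g t x = m * dt v t x + x * dt (dx v) t x).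
  { transitivity (Derive (fun s => m * v s x + x * dx v s x) t).
    (* The width T - t keeps s inside [0, T); at t = 0 the formula for g is given only to the
       right. *)
    - apply (eq_right _ _ t (T - t)); [lra|eauto with smooth real|ex_derive_smooth|].
      intros s Hs; apply Heq; lra.
    - apply is_derive_unique; auto_derive;
        [repeat split; eauto with smooth real|unfold dt; ring]. }
  assert (Ex : dx g t x = (m + 1) * dx v t x + x * dx (dx v) t x).
  { transitivity (Derive (fun y => m * v t y + y * dx v t y) x).
    - apply (eq_right _ _ x 1); [lra|eauto with smooth real|ex_derive_smooth|].
      intros y Hy; apply Heq; lra.
    - apply is_derive_unique; auto_derive;
        [repeat split; eauto with smooth real|unfold dx; ring]. }
  replace (dx p t x / x)
    with (lambda * dt v t x - v t x ^ 2 + u t x ^ 2 - x * v t x * dx v t x) in E3 by lra.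
  rewrite Et, Ex, E4 in E3.
  apply (Rmult_eq_reg_l (mu + m)); trivial; field_simplify; trivial; lra.
- exact E4.
- replace (lambda * dt v t x + u t x ^ 2 - v t x ^ 2 - x * v t x * dx v t x)
    with (dx p t x / x) by lra; field; lra.
Qed.

(** The roles are exchanged: v is expressed through g, the g-equation yields p_x, and the v-equation
    becomes the second equation of (Z0). *)
Lemma axial_ridge (m lambda mu T : R) (u v g p : R -> R -> R) :
  0 < m -> 0 < mu ->
  smooth2 T u -> smooth2 T v -> smooth2 T g -> smooth2 T p ->
  (forall t x, 0 <= t < T -> 0 < x ->
     lambda * dt u t x - m ^ 2 / 2 * v t x * u t x = - (x * g t x * dx u t x) /\
     lambda * dt v t x - v t x ^ 2 + u t x ^ 2
     = - (x * g t x * dx v t x) + dx p t x / x /\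
     lambda * dt g t x + g t x ^ 2
     = - (x * g t x * dx g t x) - mu * (dx p t x / x) /\
     g t x - m * v t x = - (x * dx g t x)) ->
  forall t x, 0 <= t < T -> 0 <= x ->
    Z0_at m lambda mu u g t x /\
    v t x = 1 / m * (g t x + x * dx g t x) /\
    dx p t x = - (1 / mu) * x * (lambda * dt g t x + g t x ^ 2
                                 + x * g t x * dx g t x).
Proof.
intros Hm Hmu Hu Hv Hg Hp Heq t x Ht Hx; unfold Z0_at.
rewrite (dt_add_xdx T) by assumption.
assert (Ev : forall s y, 0 <= s < T -> 0 < y ->
  v s y = 1 / m * (g s y + y * dx g s y)).
{ intros s y Hs Hy; destruct (Heq s y Hs Hy) as [_ [_ [_ E4]]].
  apply (Rmult_eq_reg_l m); [|lra]; field_simplify; lra. }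
repeat split; revert x Hx; (apply eq_at_apex; [ex_derive_smooth|ex_derive_smooth|]);
  intros x Hx; pose proof (Heq t x Ht Hx) as [E1 [E2 [E3 _]]];
  pose proof (Ev t x Ht Hx) as E4.
- rewrite E4 in E1.
  (* With both equations in the form difference = 0, it remains to see that the two differences
     agree identically. *)
  apply Rminus_diag_uniq; apply Rminus_diag_eq in E1; rewrite <- E1; field; lra.
- assert (Et : dt v t x = 1 / m * (dt g t x + x * dt (dx g) t x)).
  { transitivity (Derive (fun s => 1 / m * (g s x + x * dx g s x)) t).
    - apply (eq_right _ _ t (T - t)); [lra|eauto with smooth real|ex_derive_smooth|].
      intros s Hs; apply Ev; lra.
    - apply is_derive_unique; auto_derive;
        [repeat split; eauto with smooth real|unfold dt; field; lra]. }
  assert (Ex : dx v t x = 1 / m * (2 * dx g t x + x * dx (dx g) t x)).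
  { transitivity (Derive (fun y => 1 / m * (g t y + y * dx g t y)) x).
    - apply (eq_right _ _ x 1); [lra|eauto with smooth real|ex_derive_smooth|].
      intros y Hy; apply Ev; lra.
    - apply is_derive_unique; auto_derive;
        [repeat split; eauto with smooth real|unfold dx; field; lra]. }
  set (q := dx p t x / x) in *; clearbody q.
  rewrite Et, Ex, E4 in E2.
  assert (Eq : mu * q = - (lambda * dt g t x + g t x ^ 2 + x * g t x * dx g t x)) by lra.
  (* The coefficients of g_t, 1 / m from v_t and 1 / mu from the pressure, add up to this factor. *)
  apply (Rmult_eq_reg_l ((mu + m) / (mu * m)));
    [|apply Rgt_not_eq, Rdiv_lt_0_compat; [lra|apply Rmult_lt_0_compat; lra]].
  replace q with (- (lambda * dt g t x + g t x ^ 2 + x * g t x * dx g t x) / mu) in E2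
    by (apply (Rmult_eq_reg_l mu); [|lra]; rewrite Eq; field; lra).
  apply Rminus_diag_uniq; apply Rminus_diag_eq in E2; rewrite <- E2; field; lra.
- exact E4.
- replace (lambda * dt g t x + g t x ^ 2 + x * g t x * dx g t x)
    with (- mu * (dx p t x / x)) by lra; field; lra.
Qed.

(** * The apex ODEs *)

(** Every x-derivative in (R0) carries a factor x, also under the time derivative, so the
    equivalence holds for arbitrary [u] and [v]. *)
Lemma R0_apex (m lambda mu : R) (u v : R -> R -> R) (t : R) :
  R0_at m lambda mu u v t 0 <->
  R_apex_at m lambda mu (fun s => u s 0) (fun s => v s 0) t.
Proof.
unfold R0_at, R_apex_at, dt.
rewrite (Derive_ext (fun s => v s 0 + 1 / (mu + m) * 0 * dx v s 0) (fun s => v s 0))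
  by (intros s; ring).
split; intros [H1 H2]; split; rewrite ?H1, ?H2; ring.
Qed.

Lemma Z0_apex (m lambda mu : R) (u g : R -> R -> R) (t : R) :
  Z0_at m lambda mu u g t 0 <->
  Z_apex_at m lambda mu (fun s => u s 0) (fun s => g s 0) t.
Proof.
unfold Z0_at, Z_apex_at, dt.
rewrite (Derive_ext (fun s => g s 0 + mu / (mu + m) * 0 * dx g s 0) (fun s => g s 0))
  by (intros s; ring).
split; intros [H1 H2]; split; rewrite ?H1, ?H2; ring.
Qed.

(** For g = m v the second equation is m times its counterpart for v. *)
Lemma Z_apex_R_apex (m lambda mu : R) (u v : R -> R) (t : R) :
  0 < m -> 0 < mu ->
  Z_apex_at m lambda mu u (fun s => m * v s) t <-> R_apex_at m lambda mu u v t.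
Proof.
intros Hm Hmu; unfold Z_apex_at, R_apex_at; rewrite Derive_scal.
split; intros [H1 H2]; split.
- rewrite H1; field.
- apply (Rmult_eq_reg_l m); [|lra].
  transitivity (lambda * (m * Derive v t)); [ring|]; rewrite H2; field; lra.
- rewrite H1; field.
- transitivity (m * (lambda * Derive v t)); [ring|]; rewrite H2; field; lra.
Qed.

Lemma R_apex_q_apex (m q : R) (u v : R -> R) (t : R) :
  0 < m -> m ^ 2 / 2 < q ->
  R_apex_at m ((q + 1) / q * m ^ 2) ((2 * q + m) / (2 * q - m ^ 2) * m ^ 2) u v t <->
  q_apex_at m q u v t.
Proof.
intros Hm Hq.
assert (Hm2 : 0 < m ^ 2) by (apply pow_lt; lra).
(* This is the numerator of mu + m over the denominator 2 q - m^2. *)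
assert (Hd : 2 * q * m * (m + 1) <> 0)
  by (apply Rgt_not_eq; repeat apply Rmult_lt_0_compat; lra).
set (lambda := (q + 1) / q * m ^ 2).
set (mu := (2 * q + m) / (2 * q - m ^ 2) * m ^ 2).
assert (Hl : lambda <> 0).
{ apply Rgt_not_eq, Rmult_lt_0_compat; [apply Rdiv_lt_0_compat|]; lra. }
assert (Ea : (mu - m ^ 2) / (mu + m) = m ^ 2 / (2 * q)).
{ unfold mu; field; repeat split; lra. }
assert (Eb : mu / (mu + m) = m * (2 * q + m) / (2 * q * (m + 1))).
{ unfold mu; field; repeat split; lra. }
unfold R_apex_at, q_apex_at; rewrite Ea, Eb.
split; intros [H1 H2]; split.
- apply (Rmult_eq_reg_l lambda); trivial; rewrite H1; unfold lambda; field; lra.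
- apply (Rmult_eq_reg_l lambda); trivial; rewrite H2; unfold lambda; field; lra.
- rewrite H1; unfold lambda; field; lra.
- rewrite H2; unfold lambda; field; lra.
Qed.

(** Differentiating the v-equation produces (u^2)_t = q / (q + 1) v u^2 by the u-equation, and the
    v-equation itself then expresses u^2 through v and v_t. *)
Lemma q_apex_second_order (m q T : R) (u v : R -> R) :
  0 < m -> 0 < q -> 0 < T ->
  (forall t, 0 <= t < T ->
     ex_derive u t /\ ex_derive v t /\ ex_derive (Derive v) t) ->
  (forall t, 0 <= t < T -> q_apex_at m q u v t) ->
  q_second_order_ivp m q T (u 0) (v 0) v.
Proof.
intros Hm Hq HT Hd H; repeat split.
- intros t Ht; destruct (Hd t Ht) as [Hu [Hv Hv']].
  change (Derive_n v 2 t) with (Derive (Derive v) t).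
  set (k := (2 * q + m) / (m * (m + 1))).
  transitivity (Derive (fun s => 1 / (2 * (q + 1)) * (v s ^ 2 - k * u s ^ 2)) t).
  (* At t = 0 the ODE is given only to the right, which still determines the derivative. *)
  + apply (eq_right _ _ t (T - t)); [lra|assumption|auto_derive; auto|].
    intros s Hs; apply H; lra.
  + destruct (H t Ht) as [Eu Ev].
    transitivity (1 / (2 * (q + 1)) * (2 * v t * Derive v t - 2 * (k * u t ^ 2)
                                       * (q / (2 * (q + 1)) * v t))).
    * apply is_derive_unique; auto_derive; [auto|].
      change (Derive (fun x => v x) t) with (Derive v t).
      change (Derive (fun x => u x) t) with (Derive u t).
      rewrite Eu; simpl; field; lra.
    * replace (k * u t ^ 2) with (v t ^ 2 - 2 * (q + 1) * Derive v t)
        by (rewrite Ev; fold k; field; lra).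
      field; lra.
- apply H; lra.
Qed.

(** * Restriction of (BS) to the ridges *)

Lemma radial_ridge_eqs (m lambda mu T th : R) (U V G P : R -> R -> R -> R) :
  BS_solution m lambda mu T U V G P -> flat_at T th U V G P -> sin th = 0 ->
  forall t x, 0 <= t < T -> 0 < x ->
    lambda * d1 U t x th = x * V t x th * d2 U t x th + m ^ 2 / 2 * V t x th * U t x th /\
    lambda * d1 V t x th - V t x th ^ 2 + U t x th ^ 2
    = x * V t x th * d2 V t x th + d2 P t x th / x /\
    lambda * d1 G t x th + G t x th ^ 2
    = x * V t x th * d2 G t x th - mu * (d2 P t x th / x) /\
    G t x th = m * V t x th + x * d2 V t x th.
Proof.
intros HS HF Hs t x Ht Hx.
assert (Hc : cos th ^ 2 = 1)
  by (generalize (sin2_cos2 th); rewrite Hs; unfold Rsqr; lra).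
assert (HW : forall y, Wfun V G t y th = - V t y th)
  by (intros y; unfold Wfun; rewrite Hs, Hc; ring).
assert (HdW : d2 (Wfun V G) t x th = - d2 V t x th).
{ unfold d2; rewrite (Derive_ext _ _ _ HW); apply Derive_opp. }
destruct (HF t x Ht (Rlt_le _ _ Hx)) as [FP [FV [FU FG]]].
destruct (BS_eqs _ _ _ _ _ _ _ _ HS t x th Ht Hx) as [E1 [E2 [E3 E4]]].
rewrite HW, FU in E1; rewrite HW, FV, FP in E2; rewrite HW, FG, FP in E3.
(* Unfolding [Rdiv] makes the inverse of sin th, which is 0 here, a mere factor next to P_theta =
   0. *)
rewrite HdW, FV, FG in E4; unfold Rdiv in *; repeat split; lra.
Qed.

(** Now W = G along the ridge, and tan is the singular factor that P_theta = 0 removes. *)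
Lemma axial_ridge_eqs (m lambda mu T th : R) (U V G P : R -> R -> R -> R) :
  BS_solution m lambda mu T U V G P -> flat_at T th U V G P -> cos th = 0 ->
  forall t x, 0 <= t < T -> 0 < x ->
    lambda * d1 U t x th - m ^ 2 / 2 * V t x th * U t x th
    = - (x * G t x th * d2 U t x th) /\
    lambda * d1 V t x th - V t x th ^ 2 + U t x th ^ 2
    = - (x * G t x th * d2 V t x th) + d2 P t x th / x /\
    lambda * d1 G t x th + G t x th ^ 2
    = - (x * G t x th * d2 G t x th) - mu * (d2 P t x th / x) /\
    G t x th - m * V t x th = - (x * d2 G t x th).
Proof.
intros HS HF Hc t x Ht Hx.
assert (Hs : sin th ^ 2 = 1)
  by (generalize (sin2_cos2 th); rewrite Hc; unfold Rsqr; lra).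
assert (HW : forall y, Wfun V G t y th = G t y th)
  by (intros y; unfold Wfun; rewrite Hs, Hc; ring).
assert (HdW : d2 (Wfun V G) t x th = d2 G t x th)
  by exact (Derive_ext _ _ _ HW).
destruct (HF t x Ht (Rlt_le _ _ Hx)) as [FP [FV [FU FG]]].
destruct (BS_eqs _ _ _ _ _ _ _ _ HS t x th Ht Hx) as [E1 [E2 [E3 E4]]].
rewrite HW, FU in E1; rewrite HW, FV, FP in E2; rewrite HW, FG, FP in E3.
rewrite HdW, FV, FG in E4; unfold Rdiv in *; repeat split; lra.
Qed.

(** * The reductions for the background system *)

Theorem theorem2p11 :
  forall (m lambda mu T : R) (U V G P : R -> R -> R -> R),
    (m = 1 \/ m = 2) -> 0 < lambda -> 0 < mu -> 0 < T ->
    BS_solution m lambda mu T U V G P ->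
    ridge_flat T U V G P ->
    (* (A) and (B) *)
    (forall th0 : R, (th0 = 0 \/ th0 = PI) ->
       let u := fun t x => U t x th0 in
       let v := fun t x => V t x th0 in
       let g := fun t x => G t x th0 in
       let p := fun t x => P t x th0 in
       (forall t x, 0 <= t < T -> 0 <= x ->
          R0_at m lambda mu u v t x /\
          g t x = m * v t x + x * dx v t x /\
          dx p t x = x * (lambda * dt v t x + u t x ^ 2 - v t x ^ 2
                          - x * v t x * dx v t x)) /\
       (forall t, 0 <= t < T ->
          R_apex_at m lambda mu (fun s => u s 0) (fun s => v s 0) t) /\
       (forall q, m ^ 2 / 2 < q ->
          lambda = (q + 1) / q * m ^ 2 ->
          mu = (2 * q + m) / (2 * q - m ^ 2) * m ^ 2 ->
          (forall t, 0 <= t < T ->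
             q_apex_at m q (fun s => u s 0) (fun s => v s 0) t) /\
          q_second_order_ivp m q T (u 0 0) (v 0 0) (fun s => v s 0))) /\
    (* (B), reduction of the systems themselves *)
    (forall (u v : R -> R -> R) (t : R),
       R0_at m lambda mu u v t 0 <->
       R_apex_at m lambda mu (fun s => u s 0) (fun s => v s 0) t) /\
    (forall q, m ^ 2 / 2 < q ->
       lambda = (q + 1) / q * m ^ 2 ->
       mu = (2 * q + m) / (2 * q - m ^ 2) * m ^ 2 ->
       forall (u v : R -> R) (t : R),
         R_apex_at m lambda mu u v t <-> q_apex_at m q u v t) /\
    (* (C) and (D) *)
    (forall th1 : R, (th1 = PI / 2 \/ th1 = - (PI / 2)) ->
       let u := fun t x => U t x th1 in
       let v := fun t x => V t x th1 in
       let g := fun t x => G t x th1 in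
       let p := fun t x => P t x th1 in
       (forall t x, 0 <= t < T -> 0 <= x ->
          Z0_at m lambda mu u g t x /\
          v t x = 1 / m * (g t x + x * dx g t x) /\
          dx p t x = - (1 / mu) * x * (lambda * dt g t x + g t x ^ 2
                                       + x * g t x * dx g t x)) /\
       (forall t, 0 <= t < T ->
          Z_apex_at m lambda mu (fun s => u s 0) (fun s => g s 0) t)) /\
    (* (D), reduction and identification of the systems themselves *)
    (forall (u g : R -> R -> R) (t : R),
       Z0_at m lambda mu u g t 0 <->
       Z_apex_at m lambda mu (fun s => u s 0) (fun s => g s 0) t) /\
    (forall (u v : R -> R) (t : R),
       Z_apex_at m lambda mu u (fun s => m * v s) t <->
       R_apex_at m lambda mu u v t).
Proof.
intros m lambda mu T U V G P Hm12 Hlambda Hmu HT HS [F0 [Fpi [Fp Fm]]].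
assert (Hm : 0 < m) by lra.
destruct (BS_smooth _ _ _ _ _ _ _ _ HS) as [SU [SV [SG SP]]].
split; [|split; [|split; [|split; [|split]]]].
- intros th0 Hth u v g p.
  assert (F : flat_at T th0 U V G P) by (destruct Hth; subst th0; assumption).
  assert (Hs : sin th0 = 0) by (destruct Hth; subst th0; [apply sin_0|apply sin_PI]).
  assert (Su : smooth2 T u) by (apply smooth2_slice, SU).
  assert (Sv : smooth2 T v) by (apply smooth2_slice, SV).
  assert (Sg : smooth2 T g) by (apply smooth2_slice, SG).
  assert (Sp : smooth2 T p) by (apply smooth2_slice, SP).
  (* The derivatives [d1] and [d2] at th0 are convertible to [dt] and [dx] of the slices. *)
  assert (HA := radial_ridge m lambda mu T u v g p ltac:(lra) Su Sv Sg Sp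
                  (radial_ridge_eqs m lambda mu T th0 U V G P HS F Hs)).
  assert (HB : forall t, 0 <= t < T ->
            R_apex_at m lambda mu (fun s => u s 0) (fun s => v s 0) t)
    by (intros t Ht; apply R0_apex, HA; lra).
  split; [exact HA|split; [exact HB|]].
  intros q Hq El Em; subst lambda mu.
  assert (Hq' : forall t, 0 <= t < T ->
            q_apex_at m q (fun s => u s 0) (fun s => v s 0) t)
    by (intros t Ht; apply R_apex_q_apex; auto).
  split; [exact Hq'|].
  apply (q_apex_second_order m q T (fun s => u s 0) (fun s => v s 0)); trivial.
  + generalize (pow_lt m 2 Hm); lra.
  + intros t Ht; repeat split; [| |apply (smooth2_ex_dt T (dt v))];
      eauto with smooth real.
- exact (R0_apex m lambda mu).
- intros q Hq -> -> u v t; apply R_apex_q_apex; assumption.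
- intros th1 Hth u v g p.
  assert (F : flat_at T th1 U V G P) by (destruct Hth; subst th1; assumption).
  assert (Hc : cos th1 = 0)
    by (destruct Hth; subst th1; rewrite ?cos_neg; apply cos_PI2).
  assert (HC := axial_ridge m lambda mu T u v g p Hm Hmu
                  (smooth2_slice T U th1 SU) (smooth2_slice T V th1 SV)
                  (smooth2_slice T G th1 SG) (smooth2_slice T P th1 SP)
                  (axial_ridge_eqs m lambda mu T th1 U V G P HS F Hc)).
  split; [exact HC|].
  intros t Ht; apply Z0_apex, HC; lra.
- exact (Z0_apex m lambda mu).
- intros u v t; apply Z_apex_R_apex; assumption.
Qed.
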